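(* Let $N\geq 1$, let $A\in M_N(\mathbb{C})$, let $0<\epsilon<1$, and put $\epsilon_1=\frac{2\epsilon}{1-\epsilon}\|A\|$. Then $$W(A)\supseteq \operatorname{conv}(\sigma_\epsilon(A))\setminus \epsilon_1\text{-border},$$ that is, every $z\in\mathbb{C}$ with $D(z,\epsilon_1)\subseteq \operatorname{conv}(\sigma_\epsilon(A))$ belongs to $W(A)$.
   Context: $M_N(\mathbb{C})$ is the algebra of complex $N\times N$ matrices; $\|\cdot\|$ is the Euclidean norm on $\mathbb{C}^N$ and the induced operator norm (spectral norm) on $M_N(\mathbb{C})$. For a scalar $z$, $z-A$ means $zI-A$. For $0<\epsilon<1$ the $\epsilon$-condition spectrum of $A$ is $$\sigma_\epsilon(A)=\{z\in\mathbb{C}: z-A \text{ is not invertible, or } \|(z-A)^{-1}\|\,\|z-A\|\geq 1/\epsilon\}.$$ $W(A)=\{x^*Ax: x\in\mathbb{C}^N,\ \|x\|=1\}$ is the numerical range of $A$. $\operatorname{conv}(S)$ is the convex hull in $\mathbb{C}$ of $S\subseteq\mathbb{C}$. $D(a,r)=\{z\in\mathbb{C}:|z-a|\leq r\}$ is the closed disc. For $S\subseteq\mathbb{C}$ and $\delta\geq 0$, $S\setminus\delta\text{-border}$ denotes the set of $z\in\mathbb{C}$ such that $D(z,\delta)\subseteq S$. *)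

(* Defs.v *)
From HB Require Import structures.
From mathcomp Require Import all_boot all_order all_algebra.
From mathcomp Require Import complex.
From mathcomp Require Import boolp classical_sets reals.
From mathcomp Require Import interval_inference topology normedtype convex.

Set Implicit Arguments.
Unset Strict Implicit.
Unset Printing Implicit Defensive.

Import Order.TTheory GRing.Theory Num.Theory.
Import ComplexField.Normc.

Local Open Scope classical_set_scope.
Local Open Scope ring_scope.
Local Open Scope complex_scope.
Local Open Scope sesquilinear_scope.

(* The modulus used throughout is [normc : R[i] -> R], since the generic norm
   [`|z|] of a complex number is itself an element of R[i]. *)

Definition euclidean_norm (R : realType) (N : nat) (x : 'cV[R[i]]_N) : R :=
  Num.sqrt (\sum_(i < N) normc (x i 0) ^+ 2).

Definition spectral_norm (R : realType) (N : nat) (A : 'M[R[i]]_N) : R :=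
  sup [set euclidean_norm (A *m x)
      | x in [set x : 'cV[R[i]]_N | euclidean_norm x = 1]].

Definition condition_spectrum (R : realType) (N : nat) (eps : R)
    (A : 'M[R[i]]_N) : set R[i] :=
  [set z : R[i] | z%:M - A \notin unitmx \/
     spectral_norm (invmx (z%:M - A)) * spectral_norm (z%:M - A) >= 1 / eps].

(* [x ^t*] is the conjugate transpose of x. *)
Definition numerical_range (R : realType) (N : nat)
    (A : 'M[R[i]]_N) : set R[i] :=
  [set (x ^t* *m A *m x) 0 0
  | x in [set x : 'cV[R[i]]_N | euclidean_norm x = 1]].

(* Convexity is over the reals: [Rcomplex R] is R[i] as an R-module. *)
Definition convex_hull (R : realType) (S : set R[i]) : set R[i] :=
  smallest (@convex_set R (Rcomplex R)) S.

Definition closed_disc (R : realType) (a : R[i]) (r : R) : set R[i] :=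
  closed_ball_ (@normc R) a r.

Definition remove_border (R : realType) (S : set R[i]) (delta : R) : set R[i] :=
  [set z | closed_disc z delta `<=` S].

(* Main.v *)
(* Write W for the numerical range. If p is in the condition spectrum and
   d = dist(p, W) > 0, then |(p - A) x| >= d |x| for all x, hence
   |(p - A)^-1| <= 1/d and d <= eps |p - A| <= eps (d + 2 |A|), i.e.
   d <= eps1. Now let w be a point of W nearest to z (W is compact), and put
   u = z - w. By convexity of W (Toeplitz-Hausdorff), Re (u^* p) <= Re (u^* w)
   on W, so Re (u^* p) <= Re (u^* w) + |u| eps1 on the condition spectrum,
   hence on its convex hull. Evaluating this at the point z + eps1 u / |u| of
   the disc around z gives |u|^2 <= 0. *)

Require Import Defs.
From mathcomp Require Import all_boot all_order all_algebra.
From mathcomp Require Import complex.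
From mathcomp Require Import boolp classical_sets reals.
From mathcomp Require Import interval_inference topology normedtype derive convex.
From mathcomp Require Import ring lra.

Set Implicit Arguments.
Unset Strict Implicit.
Unset Printing Implicit Defensive.

Import Order.TTheory GRing.Theory Num.Theory.
Import numFieldNormedType.Exports.
Import ComplexField.Normc.

Local Open Scope classical_set_scope.
Local Open Scope ring_scope.
Local Open Scope complex_scope.
Local Open Scope sesquilinear_scope.

(** * The Hermitian inner product and the Euclidean norm on complex column vectors *)

Section EuclideanSpace.
Context {R : realType} {n : nat}.
Implicit Types (x y : 'cV[R[i]]_n) (a : R[i]).

Definition inner x y : R[i] := (x ^t* *m y) 0 0.

Lemma innerE x y : inner x y = \sum_i conjc (x i 0) * y i 0.
Proof. by rewrite /inner mxE; apply: eq_bigr => i _; rewrite !mxE. Qed.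

Lemma innerDl x y z : inner (x + y) z = inner x z + inner y z.
Proof.
by rewrite !innerE -big_split; apply: eq_bigr => i _ /=; rewrite !mxE rmorphD mulrDl.
Qed.

Lemma innerDr x y z : inner x (y + z) = inner x y + inner x z.
Proof. by rewrite /inner mulmxDr mxE. Qed.

Lemma innerZl a x y : inner (a *: x) y = conjc a * inner x y.
Proof.
by rewrite !innerE mulr_sumr; apply: eq_bigr => i _; rewrite !mxE rmorphM mulrA.
Qed.

Lemma innerZr a x y : inner x (a *: y) = a * inner x y.
Proof. by rewrite /inner -scalemxAr mxE. Qed.

Lemma innerC x y : inner y x = conjc (inner x y).
Proof.
rewrite !innerE rmorph_sum; apply: eq_bigr => i _.
by rewrite rmorphM /= conjcK mulrC.
Qed.

Lemma normc_ge0 a : 0 <= normc a.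
Proof. by case: a => u v; exact: sqrtr_ge0. Qed.

Lemma sqr_normcE a : normc a ^+ 2 = complex.Re a ^+ 2 + complex.Im a ^+ 2.
Proof. by case: a => u v /=; rewrite sqr_sqrtr // addr_ge0 ?sqr_ge0. Qed.

Lemma euclidean_norm_ge0 x : 0 <= euclidean_norm x.
Proof. exact: sqrtr_ge0. Qed.

Lemma sqr_euclidean_norm x : euclidean_norm x ^+ 2 = \sum_i normc (x i 0) ^+ 2.
Proof. by rewrite sqr_sqrtr // sumr_ge0 // => i _; rewrite sqr_ge0. Qed.

Lemma inner_norm x : inner x x = (euclidean_norm x ^+ 2)%:C.
Proof.
rewrite sqr_euclidean_norm innerE rmorph_sum; apply: eq_bigr => i _ /=.
rewrite sqr_normcE; case: (x i 0) => u v /=.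
by apply/eqP; rewrite eq_complex /=; apply/andP; split; apply/eqP; ring.
Qed.

(** [dotmx] pairs row vectors and conjugates its second argument, hence the transposes and the swap.
    This carries the general Cauchy-Schwarz and triangle inequalities over to [inner]. *)
Lemma dotmx_inner x y : dotmx y^T x^T = inner x y.
Proof.
rewrite dotmxE !mxE innerE; apply: eq_bigr => i _; rewrite !mxE mulrC.
by [].
Qed.

Lemma sqrtC_dotmx x : sqrtC (dotmx x^T x^T) = (euclidean_norm x)%:C.
Proof.
by rewrite dotmx_inner inner_norm rmorphXn /= sqrCK // ler0c euclidean_norm_ge0.
Qed.

Lemma cauchy_schwarz x y :
  normc (inner x y) <= euclidean_norm x * euclidean_norm y.
Proof.
have h : `|dotmx y^T x^T| <= sqrtC (dotmx y^T y^T) * sqrtC (dotmx x^T x^T).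
  by have [] := CauchySchwarz_sqrt (@dotmx _ n) y^T x^T.
by move: h; rewrite !sqrtC_dotmx dotmx_inner mulrC -rmorphM /= lecR.
Qed.

Lemma euclidean_normD x y :
  euclidean_norm (x + y) <= euclidean_norm x + euclidean_norm y.
Proof.
have h : sqrtC (dotmx (x + y)^T (x + y)^T)
    <= sqrtC (dotmx x^T x^T) + sqrtC (dotmx y^T y^T).
  by rewrite [(x + y)^T]linearD; have [] := triangle_lerif (@dotmx _ n) x^T y^T.
by move: h; rewrite !sqrtC_dotmx -rmorphD lecR.
Qed.

Lemma euclidean_normZ a x : euclidean_norm (a *: x) = normc a * euclidean_norm x.
Proof.
apply/eqP; rewrite -(@eqrXn2 _ 2) ?mulr_ge0 ?normc_ge0 ?euclidean_norm_ge0 //.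
rewrite exprMn !sqr_euclidean_norm mulr_sumr; apply/eqP/eq_bigr => i _.
by rewrite mxE normcM exprMn.
Qed.

Lemma euclidean_norm_eq0 x : euclidean_norm x = 0 -> x = 0.
Proof.
move=> /(congr1 (fun u => u ^+ 2)); rewrite sqr_euclidean_norm expr0n /= => /eqP.
rewrite psumr_eq0 => [/allP h|i _]; last exact: sqr_ge0.
apply/matrixP => i j; rewrite ord1 mxE; apply: eq0_normc; apply/eqP.
by have := h i; rewrite mem_index_enum sqrf_eq0 => /(_ isT).
Qed.

Lemma euclidean_norm_gt0 x : x != 0 -> 0 < euclidean_norm x.
Proof.
rewrite lt0r euclidean_norm_ge0 andbT; apply: contra_neq; exact: euclidean_norm_eq0.
Qed.

Lemma normc_coord_le x i : normc (x i 0) <= euclidean_norm x.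
Proof.
rewrite -(@ler_pXn2r _ 2) ?nnegrE ?normc_ge0 ?euclidean_norm_ge0 //.
rewrite sqr_euclidean_norm (bigD1 i) //= lerDl sumr_ge0 // => j _; exact: sqr_ge0.
Qed.

Lemma normcR (r : R) : normc r%:C = `|r|.
Proof. by rewrite /= expr0n addr0 sqrtr_sqr. Qed.

Lemma exists_unit_multiple x : x != 0 ->
  exists2 r : R, 0 < r & euclidean_norm (r%:C *: x) = 1.
Proof.
move=> /euclidean_norm_gt0 x0; exists (euclidean_norm x)^-1; first by rewrite invr_gt0.
by rewrite euclidean_normZ normcR gtr0_norm ?invr_gt0 // mulVf ?gt_eqF.
Qed.

End EuclideanSpace.

(** * Upper and lower estimates for the spectral norm *)

Section SpectralNorm.
Context {R : realType} {n : nat}.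
Implicit Types (A : 'M[R[i]]_n) (x y : 'cV[R[i]]_n).

Lemma normc_sum (I : Type) (s : seq I) (P : pred I) (F : I -> R[i]) :
  normc (\sum_(i <- s | P i) F i) <= \sum_(i <- s | P i) normc (F i).
Proof. exact: (@ler_norm_sum R (Rcomplex R)). Qed.

Lemma euclidean_norm_le_sum x : euclidean_norm x <= \sum_i normc (x i 0).
Proof.
have s0 : 0 <= \sum_i normc (x i 0) by apply: sumr_ge0 => i _; exact: normc_ge0.
rewrite -(@ler_pXn2r _ 2) ?nnegrE ?euclidean_norm_ge0 //.
rewrite sqr_euclidean_norm expr2 mulr_suml ler_sum // => i _.
rewrite expr2 ler_wpM2l ?normc_ge0 // (bigD1 i) //= lerDl.
by apply: sumr_ge0 => j _; exact: normc_ge0.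
Qed.

Lemma spectral_norm_ub A x : euclidean_norm x = 1 ->
  euclidean_norm (A *m x) <= spectral_norm A.
Proof.
move=> x1; apply: sup_ubound; last by exists x.
(* The supremum is meaningful only for a bounded set. The sum of the moduli of all entries is a
   bound, since the coordinates of a unit vector have modulus at most 1. *)
exists (\sum_i \sum_j normc (A i j)) => _ [y /= y1 <-].
apply: le_trans (euclidean_norm_le_sum _) _; apply: ler_sum => i _.
rewrite mxE; apply: le_trans (normc_sum _ _ _) _; apply: ler_sum => j _.
by rewrite normcM ler_piMr ?normc_ge0 // -y1 normc_coord_le.
Qed.

Lemma unit_vector_exists : (0 < n)%N ->
  exists x : 'cV[R[i]]_n, euclidean_norm x = 1.
Proof.
move=> n0; have [|r _ r1] := @exists_unit_multiple R n (const_mx 1);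
  last by eexists; exact: r1.
by apply/eqP => /matrixP /(_ (Ordinal n0) 0); rewrite !mxE => /eqP; rewrite oner_eq0.
Qed.

Lemma spectral_norm_le A (c : R) : (0 < n)%N ->
  (forall x, euclidean_norm x = 1 -> euclidean_norm (A *m x) <= c) ->
  spectral_norm A <= c.
Proof.
(* A positive dimension provides a unit vector, so the supremum is over a nonempty set. *)
move=> n0 h; apply: ge_sup => [|_ [x /= x1 <-]]; last exact: h.
by have [x x1] := unit_vector_exists n0; exists (euclidean_norm (A *m x)), x.
Qed.

End SpectralNorm.

(** * Continuity of complex-valued functions *)

Section ComplexContinuity.
Context {R : realType} {T : topologicalType}.
Implicit Types f g : T -> R[i].

(** Stated through real and imaginary parts, so that only limits of real-valued functions are ever
    computed. *)
Definition ccontinuous f :=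
  continuous (fun v => complex.Re (f v) : R) /\
  continuous (fun v => complex.Im (f v) : R).

Lemma ccontinuous_cst (a : R[i]) : ccontinuous (fun=> a).
Proof. by split => v; exact: cvg_cst. Qed.

Lemma ccontinuousD f g : ccontinuous f -> ccontinuous g ->
  ccontinuous (fun v => f v + g v).
Proof.
move=> [f1 f2] [g1 g2]; split => v.
  rewrite (_ : (fun v => _) = (fun v => complex.Re (f v) + complex.Re (g v))).
    by apply: cvgD; [exact: f1|exact: g1].
  by apply/funext => u; case: (f u) => ? ?; case: (g u).
rewrite (_ : (fun v => _) = (fun v => complex.Im (f v) + complex.Im (g v))).
  by apply: cvgD; [exact: f2|exact: g2].
by apply/funext => u; case: (f u) => ? ?; case: (g u).
Qed.

Lemma ccontinuousM f g : ccontinuous f -> ccontinuous g ->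
  ccontinuous (fun v => f v * g v).
Proof.
move=> [f1 f2] [g1 g2]; split => v.
  rewrite (_ : (fun v => _) = (fun v => complex.Re (f v) * complex.Re (g v)
                                      - complex.Im (f v) * complex.Im (g v))).
    by apply: cvgB; apply: cvgM; [exact: f1|exact: g1|exact: f2|exact: g2].
  by apply/funext => u; case: (f u) => ? ?; case: (g u).
rewrite (_ : (fun v => _) = (fun v => complex.Re (f v) * complex.Im (g v)
                                    + complex.Im (f v) * complex.Re (g v))).
  by apply: cvgD; apply: cvgM; [exact: f1|exact: g2|exact: f2|exact: g1].
by apply/funext => u; case: (f u) => ? ?; case: (g u).
Qed.

Lemma ccontinuous_conj f : ccontinuous f -> ccontinuous (fun v => conjc (f v)).
Proof.
move=> [f1 f2]; split => v.
  rewrite (_ : (fun v => _) = (fun v => complex.Re (f v))); first exact: f1.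
  by apply/funext => u; case: (f u).
rewrite (_ : (fun v => _) = (fun v => - complex.Im (f v))).
  by apply: cvgN; exact: f2.
by apply/funext => u; case: (f u).
Qed.

Lemma ccontinuous_sum (I : Type) (s : seq I) (F : I -> T -> R[i]) :
  (forall i, ccontinuous (F i)) -> ccontinuous (fun v => \sum_(i <- s) F i v).
Proof.
move=> h; elim: s => [|i s ih].
  rewrite (_ : (fun v => _) = fun=> 0); first exact: ccontinuous_cst.
  by apply/funext => v; rewrite big_nil.
rewrite (_ : (fun v => _) = fun v => F i v + \sum_(j <- s) F j v).
  exact: ccontinuousD.
by apply/funext => v; rewrite big_cons.
Qed.

Lemma continuous_sqr_normc f : ccontinuous f ->
  continuous (fun v => normc (f v) ^+ 2 : R).
Proof.
move=> [f1 f2] v.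
rewrite (_ : (fun v => _) = (fun v => complex.Re (f v) * complex.Re (f v)
                                    + complex.Im (f v) * complex.Im (f v))).
  by apply: cvgD; apply: cvgM; [exact: f1|exact: f1|exact: f2|exact: f2].
by apply/funext => u; rewrite sqr_normcE !expr2.
Qed.

End ComplexContinuity.

(** * Compactness of the unit sphere and nearest points of the numerical range *)

Section NearestPoint.
Context {R : realType} {n : nat}.

(** The identification of real 2n-space with complex n-space. It makes the Heine-Borel and extreme
    value theorems for real row vectors applicable. *)
Definition complex_vector (v : 'rV[R]_(n + n)) : 'cV[R[i]]_n :=
  \col_i (v 0 (lshift n i) +i* v 0 (rshift n i)).

Lemma complex_vector_surj (x : 'cV[R[i]]_n) : exists v, complex_vector v = x.
Proof.
exists (row_mx (\row_i complex.Re (x i 0)) (\row_i complex.Im (x i 0))).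
apply/matrixP => i j; rewrite ord1 !mxE.
by rewrite (unsplitK (inl i)) (unsplitK (inr i)) !mxE; case: (x i 0).
Qed.

Lemma ccontinuous_complex_vector i :
  ccontinuous (fun v => complex_vector v i 0).
Proof.
split => v.
  rewrite (_ : (fun v => _) = (fun v : 'rV[R]_(n + n) => v 0 (lshift n i))).
    exact: coord_continuous.
  by apply/funext => u; rewrite mxE.
rewrite (_ : (fun v => _) = (fun v : 'rV[R]_(n + n) => v 0 (rshift n i))).
  exact: coord_continuous.
by apply/funext => u; rewrite mxE.
Qed.

Lemma continuous_sqr_euclidean_norm :
  continuous (fun v => euclidean_norm (complex_vector v) ^+ 2 : R).
Proof.
have -> : (fun v => euclidean_norm (complex_vector v) ^+ 2) =
    (fun v => complex.Re (inner (complex_vector v) (complex_vector v))).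
  by apply/funext => v; rewrite inner_norm.
suff [] : ccontinuous (fun v => inner (complex_vector v) (complex_vector v)) by [].
under eq_fun do rewrite innerE.
apply: ccontinuous_sum => i; apply: ccontinuousM.
  by apply: ccontinuous_conj; exact: ccontinuous_complex_vector.
exact: ccontinuous_complex_vector.
Qed.

Lemma ccontinuous_form (A : 'M[R[i]]_n) :
  ccontinuous (fun v => inner (complex_vector v) (A *m complex_vector v)).
Proof.
under eq_fun do rewrite innerE.
apply: ccontinuous_sum => i; apply: ccontinuousM.
  by apply: ccontinuous_conj; exact: ccontinuous_complex_vector.
under eq_fun do rewrite mxE.
apply: ccontinuous_sum => j; apply: ccontinuousM; first exact: ccontinuous_cst.
exact: ccontinuous_complex_vector.
Qed.

Lemma euclidean_norm_eq1 (x : 'cV[R[i]]_n) :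
  (euclidean_norm x = 1) <-> (euclidean_norm x ^+ 2 = 1).
Proof.
split=> [->|/eqP]; first by rewrite expr1n.
by rewrite sqrp_eq1 ?euclidean_norm_ge0 // => /eqP.
Qed.

Lemma compact_sphere :
  compact [set v | euclidean_norm (complex_vector v) = 1].
Proof.
apply: bounded_closed_compact.
  (* The norm on real row vectors is the maximum of the moduli of the entries, and each entry is the
     real or imaginary part of a coordinate of a unit vector. *)
  exists 1; split => // M M1 v /= v1.
  rewrite /Num.norm /= mx_normrE; apply/bigmax_leP; split.
    by rewrite ltW ?(lt_trans ltr01).
  move=> [i j] _ /=; rewrite ord1; apply: le_trans (ltW M1); rewrite -v1.
  have cplx (a b : R) : `|a| <= normc (a +i* b) /\ `|b| <= normc (a +i* b).
    by rewrite /= -!sqrtr_sqr !ler_sqrt ?addr_ge0 ?sqr_ge0 // lerDl lerDr !sqr_ge0.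
  rewrite -(splitK j); case: (split j) => k /=;
    apply: le_trans (normc_coord_le _ k); rewrite mxE.
    exact: (cplx _ _).1.
  exact: (cplx _ _).2.
(* Closedness: the squared norm, a polynomial in the real coordinates, is continuous, and the sphere
   is its preimage of 1. *)
rewrite (_ : [set _ | _] =
   (fun v => euclidean_norm (complex_vector v) ^+ 2) @^-1` [set 1 : R]).
  apply: preimage_closed; last exact: closed_eq.
  by move=> v _; exact: continuous_sqr_euclidean_norm.
by apply/seteqP; split => v /= /euclidean_norm_eq1.
Qed.

(** The squared distance from p to the value of the form is continuous on the compact nonempty unit
    sphere, so it attains its minimum. *)
Lemma numerical_range_nearest (A : 'M[R[i]]_n) (p : R[i]) : (0 < n)%N ->
  exists2 x : 'cV[R[i]]_n, euclidean_norm x = 1 &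
    forall y : 'cV[R[i]]_n, euclidean_norm y = 1 ->
      normc (p - inner x (A *m x)) <= normc (p - inner y (A *m y)).
Proof.
move=> n0.
have S0 : [set v | euclidean_norm (complex_vector v) = 1 :> R] !=set0.
  have [x x1] := @unit_vector_exists R n n0.
  by have [v vx] := complex_vector_surj x; exists v; rewrite /= vx.
have cf : {within [set v | euclidean_norm (complex_vector v) = 1 :> R],
  continuous (fun v => normc (p - inner (complex_vector v)
                                   (A *m complex_vector v)) ^+ 2)}.
  apply: continuous_subspaceT; apply: continuous_sqr_normc.
  apply: ccontinuousD; first exact: ccontinuous_cst.
  under eq_fun do rewrite -mulN1r.
  by apply: ccontinuousM; [exact: ccontinuous_cst|exact: ccontinuous_form].
have [v] := EVT_min_rV S0 compact_sphere cf.
rewrite inE /= => v1 vmin; exists (complex_vector v) => // y y1.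
have [u uy] := complex_vector_surj y.
have := vmin u; rewrite inE /= uy => /(_ y1).
by rewrite ler_pXn2r // nnegrE normc_ge0.
Qed.

End NearestPoint.

(** * The Toeplitz-Hausdorff theorem: convexity of the numerical range *)

Section ToeplitzHausdorff.
Context {R : realType} {n : nat}.
Implicit Types (A B : 'M[R[i]]_n) (x y v : 'cV[R[i]]_n).

Lemma inner_comb (a : R) B x y :
  inner (a%:C *: x + y) (B *m (a%:C *: x + y)) =
  (a ^+ 2)%:C * inner x (B *m x)
  + a%:C * (inner x (B *m y) + inner y (B *m x)) + inner y (B *m y).
Proof.
rewrite mulmxDr -scalemxAr !innerDl !innerDr !innerZl !innerZr conjc_real rmorphXn /=.
by ring.
Qed.

(** The signs of a and c make the discriminant at least [b ^+ 2], hence nonnegative. *)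
Lemma quadratic_root (a b c : R) : 0 < a -> c <= 0 ->
  exists t, a * t ^+ 2 + b * t + c = 0.
Proof.
move=> a0 c0; exists ((Num.sqrt (b ^+ 2 - 4 * a * c) - b) / (2 * a)).
have d0 : 0 <= b ^+ 2 - 4 * a * c.
  by rewrite subr_ge0 (le_trans _ (sqr_ge0 b)) // mulr_ge0_le0 // mulr_ge0 // ltW.
have := sqr_sqrtr d0; move: (Num.sqrt _) => s hs.
apply/eqP; rewrite -(mulrI_eq0 _ (mulfI (lt0r_neq0 a0))); apply/eqP.
have -> : a * (a * ((s - b) / (2 * a)) ^+ 2 + b * ((s - b) / (2 * a)) + c) =
   (s ^+ 2 - b ^+ 2) / 4 + a * c by field; rewrite gt_eqF.
by rewrite hs; field.
Qed.

Lemma Re_sum_conj (a : R[i]) : a + conjc a = (2 * complex.Re a)%:C.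
Proof.
by case: a => u w; apply/eqP; rewrite eq_complex /=; apply/andP; split; apply/eqP; ring.
Qed.

(** Take v = a x + y with a real. As the cross terms add up to a real number, the required equality
    is a real quadratic equation in a, with leading coefficient t |x|^2 > 0 and constant term t - 1
    <= 0, so it has a root. *)
Lemma toeplitz_hausdorff_real B x y (k t : R) :
  x != 0 -> inner x (B *m x) = 0 -> euclidean_norm y = 1 ->
  inner y (B *m y) = 1 -> inner x (B *m y) + inner y (B *m x) = k%:C ->
  0 < t -> t <= 1 ->
  exists2 v, v != 0 & inner v (B *m v) = t%:C * inner v v.
Proof.
move=> /euclidean_norm_gt0 x0 Bx y1 By hk t0 t1.
have [a ha] : exists a, (t * euclidean_norm x ^+ 2) * a ^+ 2
    + (t * (2 * complex.Re (inner x y)) - k) * a + (t - 1) = 0.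
  by apply: quadratic_root; rewrite ?mulr_gt0 ?exprn_gt0 // subr_le0.
exists (a%:C *: x + y).
  (* If v were 0, then y would be a multiple of x and the form of B would vanish at y instead of
     being 1. *)
  apply/eqP => /eqP; rewrite addrC addr_eq0 => /eqP yx.
  move: By; rewrite yx -scaleNr -scalemxAr innerZl innerZr Bx !mulr0 => /eqP.
  by rewrite eq_sym oner_eq0.
have := inner_comb a 1%:M x y; rewrite !mul1mx => ->.
rewrite inner_comb Bx By hk mulr0 add0r !inner_norm y1 (innerC x y) Re_sum_conj.
move: (complex.Re _) ha => c ha.
apply/eqP; rewrite eq_complex /=; apply/andP; split; apply/eqP; last by ring.
apply/eqP; rewrite -subr_eq0 -oppr_eq0; apply/eqP; rewrite -[RHS]ha; ring.
Qed.

(* Rescaling x by [p - r^*], where p and r are the two cross terms, makes the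
   sum of the cross terms equal to [|p|^2 - |r|^2]. *)
Lemma toeplitz_hausdorff_unit B x y (t : R) :
  x != 0 -> inner x (B *m x) = 0 -> euclidean_norm y = 1 ->
  inner y (B *m y) = 1 -> 0 < t -> t <= 1 ->
  exists2 v, v != 0 & inner v (B *m v) = t%:C * inner v v.
Proof.
move=> x0 Bx y1 By t0 t1.
set p := inner x (B *m y); set r := inner y (B *m x).
(* When the rescaling factor vanishes, p + r = 2 Re r is already real and x can be kept. *)
have [pr|pr] := eqVneq p (conjc r).
  apply: (@toeplitz_hausdorff_real B x y (2 * complex.Re r) t) => //.
  by rewrite -/p -/r pr addrC Re_sum_conj.
apply: (@toeplitz_hausdorff_real B ((p - conjc r) *: x) y
   (normc p ^+ 2 - normc r ^+ 2) t) => //.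
- by rewrite scaler_eq0 negb_or x0 subr_eq0 pr.
- by rewrite -scalemxAr innerZl innerZr Bx !mulr0.
rewrite -scalemxAr innerZl innerZr -/p -/r !sqr_normcE.
case: p r {pr} => [p1 p2] [r1 r2].
by apply/eqP; rewrite eq_complex /=; apply/andP; split; apply/eqP; ring.
Qed.

Lemma toeplitz_hausdorff A x y (t : R) :
  euclidean_norm x = 1 -> euclidean_norm y = 1 -> 0 <= t -> t <= 1 ->
  exists2 v, euclidean_norm v = 1 & inner v (A *m v) =
    inner x (A *m x) + t%:C * (inner y (A *m y) - inner x (A *m x)).
Proof.
move=> x1 y1 t0 t1; set a := inner x _; set b := inner y _.
have [ab|ab] := eqVneq b a; first by exists x; rewrite // ab subrr mulr0 addr0.
(* The endpoint t = 0 is split off, because the quadratic equation degenerates there. *)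
move: t0; rewrite le_eqVlt => /predU1P[<-|t0].
  by exists x; rewrite // mul0r addr0.
have ab0 : b - a != 0 by rewrite subr_eq0.
have normed (z : 'cV[R[i]]_n) : euclidean_norm z = 1 -> inner z z = 1.
  by move=> z1; rewrite inner_norm z1 expr1n.
(* The affine change of matrix that sends the value a at x to 0 and the value b at y to 1. *)
pose B := (b - a)^-1 *: (A - a%:M).
have BE z : inner z (B *m z) = (b - a)^-1 * (inner z (A *m z) - a * inner z z).
  rewrite -scalemxAl innerZr mulmxBl mul_scalar_mx -scaleNr innerDr innerZr.
  by rewrite mulNr.
have [|||v v0 hv] := @toeplitz_hausdorff_unit B x y t _ _ y1 _ t0 t1.
- by apply/eqP => xE; move: (normed _ x1); rewrite xE -(scale0r 0) innerZr mul0r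
     => /eqP; rewrite eq_sym oner_eq0.
- by rewrite BE (normed _ x1) mulr1 subrr mulr0.
- by rewrite BE (normed _ y1) mulr1 mulVf.
(* Both sides of [hv] scale by r^2, so v may be normalised before the affine change is undone. *)
have [r r0 r1] := exists_unit_multiple v0; exists (r%:C *: v) => //.
have : inner (r%:C *: v) (B *m (r%:C *: v)) = t%:C * inner (r%:C *: v) (r%:C *: v).
  by rewrite -scalemxAr !innerZl !innerZr hv; ring.
rewrite BE (normed _ r1) !mulr1 => /(congr1 (fun u => a + (b - a) * u)).
by rewrite mulVKf // addrC subrK => ->; rewrite mulrC.
Qed.

End ToeplitzHausdorff.

(** * Distance from the condition spectrum to the numerical range *)

Section ConditionSpectrum.
Context {R : realType} {n : nat}.
Implicit Types (A M : 'M[R[i]]_n) (x y : 'cV[R[i]]_n).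

Lemma numerical_radius_le A x : euclidean_norm x = 1 ->
  normc (inner x (A *m x)) <= spectral_norm A.
Proof.
move=> x1; apply: le_trans (cauchy_schwarz _ _) _.
by rewrite x1 mul1r spectral_norm_ub.
Qed.

Lemma spectral_norm_ge0 A : (0 < n)%N -> 0 <= spectral_norm A.
Proof.
move=> /(@unit_vector_exists R) [x x1].
by apply: le_trans (spectral_norm_ub A x1); exact: euclidean_norm_ge0.
Qed.

(** The lower bound makes M injective. [det0P] speaks of left kernels, so it is applied to the
    transpose of M. *)
Lemma bounded_below_unitmx M (d : R) : 0 < d ->
  (forall x, d * euclidean_norm x <= euclidean_norm (M *m x)) -> M \in unitmx.
Proof.
move=> d0 h; rewrite -unitmx_tr unitmxE unitfE; apply/det0P => -[v v0 vM].
have := h v^T; rewrite -(trmxK M) -trmx_mul vM trmx0.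
have := @euclidean_normZ R n 0 0; rewrite scale0r normc0 mul0r => ->.
rewrite leNgt mulr_gt0 // euclidean_norm_gt0 //.
by apply: contra_neq v0 => /(congr1 trmx); rewrite trmxK trmx0.
Qed.

Lemma spectral_norm_invmx_le M (d : R) : (0 < n)%N -> 0 < d ->
  (forall x, d * euclidean_norm x <= euclidean_norm (M *m x)) ->
  spectral_norm (invmx M) <= d^-1.
Proof.
move=> n0 d0 h; have uM := bounded_below_unitmx d0 h.
apply: spectral_norm_le => // x x1.
have := h (invmx M *m x); rewrite mulKVmx // x1.
by rewrite -ler_pdivlMl // mulr1.
Qed.

(** For a unit vector x the number p - <x, A x> equals <x, (p - A) x>, which Cauchy-Schwarz bounds
    by |(p - A) x|. The general case follows by homogeneity. *)
Lemma shift_bounded_below A (p : R[i]) (d : R) :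
  (forall x, euclidean_norm x = 1 -> d <= normc (p - inner x (A *m x))) ->
  forall x, d * euclidean_norm x <= euclidean_norm ((p%:M - A) *m x).
Proof.
move=> h x; have [->|x0] := eqVneq x 0.
  by rewrite mulmx0 -(scale0r 0) euclidean_normZ normc0 mul0r mulr0.
have [r r0 r1] := exists_unit_multiple x0.
have e : inner (r%:C *: x) ((p%:M - A) *m (r%:C *: x)) =
         p - inner (r%:C *: x) (A *m (r%:C *: x)).
  rewrite mulmxBl mul_scalar_mx innerDr innerZr inner_norm r1 expr1n mulr1.
  by rewrite -scaleN1r innerZr mulN1r.
have := le_trans (h _ r1) _; rewrite -e => /(_ _ (cauchy_schwarz _ _)).
rewrite r1 mul1r -scalemxAr.
move: r1; rewrite !euclidean_normZ normcR gtr0_norm // => r1 hd.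
rewrite -(@ler_pM2l _ r) //; apply: le_trans hd.
by rewrite mulrCA r1 mulr1.
Qed.

Lemma condition_spectrum_near A (eps : R) (p : R[i]) :
  (0 < n)%N -> 0 < eps -> eps < 1 -> condition_spectrum eps A p ->
  exists2 x, euclidean_norm x = 1 & normc (p - inner x (A *m x))
    <= 2 * eps / (1 - eps) * spectral_norm A.
Proof.
move=> n0 e0 e1 hp; have [x x1 xmin] := @numerical_range_nearest _ _ A p n0.
exists x => //; set d := normc _ in xmin *.
have s0 := spectral_norm_ge0 A n0; set s := spectral_norm A in s0 *.
have e1' : 0 < 1 - eps by rewrite subr_gt0.
have : 0 <= d by exact: normc_ge0.
(* If d = 0, the claim is only that the right-hand side is nonnegative. *)
rewrite le_eqVlt => /predU1P[<-|d0].
  by rewrite !mulr_ge0 ?invr_ge0 // ltW.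
have hM := shift_bounded_below xmin.
(* For d > 0 the matrix p - A is invertible, so p satisfies the norm condition. *)
case: hp => [|hp]; first by rewrite (bounded_below_unitmx d0 hM).
have pd : normc p <= d + s.
  rewrite -[p](subrK (inner x (A *m x))); apply: le_trans (le_normcD _ _) _.
  by rewrite lerD2l numerical_radius_le.
have hs : spectral_norm (p%:M - A) <= d + 2 * s.
  apply: spectral_norm_le => // y y1.
  rewrite mulmxBl mul_scalar_mx; apply: le_trans (euclidean_normD _ _) _.
  rewrite -scaleN1r !euclidean_normZ normcN normc1 y1 mul1r mulr1.
  by have := spectral_norm_ub A y1; rewrite -/s => ?; lra.
have {}hp : 1 / eps <= d^-1 * (d + 2 * s).
  apply: le_trans hp _; apply: ler_pM hs; rewrite ?spectral_norm_ge0 //.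
  exact: spectral_norm_invmx_le.
have {}hp : d <= eps * (d + 2 * s).
  move: hp; rewrite -(@ler_pM2l _ (d * eps)) ?mulr_gt0 //.
  rewrite (_ : d * eps * (1 / eps) = d); last by field; rewrite gt_eqF.
  by rewrite (_ : d * eps * (d^-1 * _) = eps * (d + 2 * s)) //; field; rewrite gt_eqF.
(* Solving d <= eps (d + 2 s) for d gives the constant 2 eps / (1 - eps). *)
rewrite mulrAC ler_pdivlMr //; lra.
Qed.

(** * Half-planes containing the convex hull and the numerical range *)

Lemma halfplane_convex_hull (S : set R[i]) (u : R[i]) (c : R) :
  (forall p, S p -> complex.Re (conjc u * p) <= c) ->
  forall p, convex_hull S p -> complex.Re (conjc u * p) <= c.
Proof.
move=> hS p hp; apply: (hp [set q | complex.Re (conjc u * q) <= c]); split => //.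
move=> x y l; rewrite !inE /= => xc yc.
rewrite (_ : complex.Re _ = l%:num * complex.Re (conjc u * x)
                          + (1 - l%:num) * complex.Re (conjc u * y)).
  have l0 : 0 <= l%:num by [].
  have l1 : l%:num <= 1 by [].
  by nra.
case: x y u {hS hp xc yc} => [x1 x2] [y1 y2] [u1 u2] /=.
by rewrite /unstable.onem /=; ring.
Qed.

Lemma Re_mul_conj_le (u v : R[i]) : complex.Re (conjc u * v) <= normc u * normc v.
Proof.
rewrite -[normc u](_ : normc (conjc u) = _); last by case: u => a b /=; rewrite sqrrN.
rewrite -normcM; case: (_ * _) => a b /=; apply: le_trans (ler_norm _) _.
by rewrite -sqrtr_sqr ler_sqrt ?addr_ge0 ?sqr_ge0 // lerDl sqr_ge0.
Qed.

(** The obtuse angle criterion for a nearest point w: by convexity the segment from w to any other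
    point q of the numerical range stays in it, and no point of it is closer to z than w. *)
Lemma numerical_range_supporting A (z : R[i]) x :
  euclidean_norm x = 1 ->
  (forall y, euclidean_norm y = 1 ->
    normc (z - inner x (A *m x)) <= normc (z - inner y (A *m y))) ->
  forall y, euclidean_norm y = 1 ->
  complex.Re (conjc (z - inner x (A *m x)) * inner y (A *m y))
    <= complex.Re (conjc (z - inner x (A *m x)) * inner x (A *m x)).
Proof.
move=> x1 xmin y y1.
have seg t : 0 <= t -> t <= 1 ->
    normc (z - inner x (A *m x)) ^+ 2 <=
    normc (z - (inner x (A *m x)
           + t%:C * (inner y (A *m y) - inner x (A *m x)))) ^+ 2.
  move=> t0 t1; have [v v1 <-] := toeplitz_hausdorff A x1 y1 t0 t1.
  by rewrite ler_pXn2r ?nnegrE ?normc_ge0 // xmin.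
move: (inner x _) (inner y _) seg => [a b] [c d] {xmin}.
case: z => e f seg; rewrite /=.
set X := e - a; set Y := f - b; set U := c - a; set V := d - b.
suff : X * U + Y * V <= 0 by rewrite /U /V; lra.
rewrite leNgt; apply/negP => k0; set k := X * U + Y * V in k0.
(* Here k is the real inner product of z - w with q - w; expanding |z - w - t (q - w)|^2 >= |z -
   w|^2 gives this bound. *)
have seg2 t : 0 <= t -> t <= 1 -> 2 * t * k <= t ^+ 2 * (U ^+ 2 + V ^+ 2).
  move=> t0 t1; have := seg t t0 t1; rewrite !sqr_normcE /= -subr_ge0.
  by rewrite -(subr_ge0 (2 * t * k)) /k /X /Y /U /V => h; lra.
have D0 : 0 < U ^+ 2 + V ^+ 2.
  rewrite lt_neqAle addr_ge0 ?sqr_ge0 // andbT eq_sym paddr_eq0 ?sqr_ge0 //.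
  rewrite !sqrf_eq0; apply/negP => /andP[/eqP u0 /eqP v0].
  by move: k0; rewrite /k u0 v0 !mulr0 addr0 ltxx.
set D := U ^+ 2 + V ^+ 2 in D0 seg2.
(* The choice t = min(1, k / D) contradicts k > 0: for k <= D it yields 2 k^2 / D <= k^2 / D, and
   for k > D it yields 2 k <= D < k. *)
have [kD|Dk] := lerP k D.
  have := seg2 (k / D); rewrite divr_ge0 ?ler_pdivrMr ?mul1r ?kD ?(ltW k0) ?(ltW D0) //.
  move=> /(_ isT isT).
  rewrite (_ : _ ^+ 2 * D = k / D * k); last by field; rewrite gt_eqF.
  have : 0 < k / D * k by rewrite !mulr_gt0 ?invr_gt0.
  lra.
have := seg2 1 ler01 (lexx _); rewrite expr1n mulr1 mul1r; lra.
Qed.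

End ConditionSpectrum.

Theorem mainTheorem7 (R : realType) (N : nat) (hN : (1 <= N)%N)
    (A : 'M[R[i]]_N) (eps : R) (heps0 : 0 < eps) (heps1 : eps < 1) :
  let eps1 : R := 2 * eps / (1 - eps) * spectral_norm A in
  remove_border (convex_hull (condition_spectrum eps A)) eps1
    `<=` numerical_range A.
Proof.
move: hN heps0 heps1 => n0 e0 e1 eps1 z hz.
have [x x1 xmin] := @numerical_range_nearest _ _ A z n0.
set w := inner x (A *m x) in xmin; pose u := z - w.
have supp := numerical_range_supporting x1 xmin; rewrite -/w -/u in supp.
have [u0|u0] := eqVneq u 0.
  exists x => //; rewrite -mulmxA; change (w = z).
  by apply/eqP; rewrite eq_sym -subr_eq0; apply/eqP.
have U0 : 0 < normc u.
  rewrite lt0r normc_ge0 andbT; apply: contra_neq u0; exact: eq0_normc.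
have eps10 : 0 <= eps1.
  by rewrite !mulr_ge0 ?invr_ge0 ?spectral_norm_ge0 // ltW // subr_gt0.
have half p : condition_spectrum eps A p ->
    complex.Re (conjc u * p) <= complex.Re (conjc u * w) + normc u * eps1.
  move=> /(condition_spectrum_near n0 e0 e1) [y y1 hy].
  (* Split p into a point of the numerical range, controlled by [supp], and a remainder of modulus
     at most eps1. *)
  rewrite -[p](subrK (inner y (A *m y))) mulrDr raddfD /= addrC lerD ?supp //.
  apply: le_trans (Re_mul_conj_le _ _) _.
  by rewrite ler_wpM2l ?normc_ge0.
(* The point of the disc around z that lies farthest in the direction u. *)
pose q := z + (eps1 / normc u)%:C * u.
have qz : closed_disc z eps1 q.
  rewrite /closed_disc /closed_ball_ /= opprD addNKr normcN normcM normcR.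
  by rewrite ger0_norm ?divr_ge0 ?normc_ge0 // divfK // gt_eqF.
have := halfplane_convex_hull half (hz q qz).
(* Substituting z = w + u lets the terms in w and |u| eps1 cancel against the half-plane bound,
   leaving |u|^2 <= 0. *)
have -> : conjc u * q = conjc u * w + (conjc u * u + (eps1 / normc u)%:C * (conjc u * u)).
  by rewrite /q -[z](subrK w) -/u; ring.
have -> : conjc u * u = (normc u ^+ 2)%:C.
  rewrite sqr_normcE; case: (u) => a b.
  by apply/eqP; rewrite eq_complex /=; apply/andP; split; apply/eqP; ring.
rewrite raddfD /= mul0r subr0 lerD2l.
rewrite (_ : eps1 / normc u * normc u ^+ 2 = normc u * eps1);
  last by field; rewrite gt_eqF.
by rewrite gerDr leNgt exprn_gt0.
Qed.
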